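(* Let $M$ be a compact metrizable space and let the homeomorphism $f\colon M\to M$ be a monotone extension of the homeomorphism $\tilde f\colon\tilde M\to\tilde M$ with quotient map $q\colon M\to\tilde M$. The following statements are equivalent: 1. $\tilde f$ is cw-expansive; 2. there is a metric on $M$ compatible with its topology and a constant $\xi>0$ such that, with respect to this metric, $f$ is half cw-expansive with half cw-expansivity constant $\xi$, and for all $x,y\in M$ we have $q(x)=q(y)$ if and only if there is a $\xi$-stable continuum containing $x$ and $y$.
   Context: A continuum is a non-empty compact connected set; it is trivial if it is a single point. For a homeomorphism $f\colon M\to M$ of a metric space $(M,\operatorname{dist})$ and $\xi>0$, a subset $C\subseteq M$ is $\xi$-stable if $\operatorname{diam} f^n(C)\le\xi$ for all $n\in\mathbb Z$. A homeomorphism $g\colon N\to N$ of a topological space $N$ is cw-expansive if there exist a metric on $N$ compatible with its topology and $\xi>0$ such that every $\xi$-stable continuum is trivial. A homeomorphism $f$ of a metric space is half cw-expansive with half cw-expansivity constant $\xi>0$ if every $\xi$-stable continuum is $\xi/2$-stable. A homeomorphism $f\colon M\to M$ is an extension of a homeomorphism $\tilde f\colon\tilde M\to\tilde M$ with quotient map $q\colon M\to\tilde M$ if $q$ is surjective, $\tilde M$ has the quotient (final) topology induced by $q$, and $q\circ f=\tilde f\circ q$. The extension is monotone if $q^{-1}(z)$ is connected for every $z\in\tilde M$. *)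

(* Defs.v *)
From HB Require Import structures.
From mathcomp Require Import all_boot all_order all_algebra.
From mathcomp Require Import all_classical all_reals all_analysis.
Set Implicit Arguments.
Unset Strict Implicit.
Unset Printing Implicit Defensive.
Import Order.TTheory GRing.Theory Num.Theory.

Local Open Scope classical_set_scope.
Local Open Scope ring_scope.

Record homeo (T : topologicalType) := Homeo {
  homeo_fun :> T -> T;
  homeo_inv : T -> T;
  homeoK : cancel homeo_fun homeo_inv;
  homeo_invK : cancel homeo_inv homeo_fun;
  homeo_continuous : continuous homeo_fun;
  homeo_inv_continuous : continuous homeo_inv
}.

(* [Negz k] is the integer [- k.+1] *)
Definition homeo_iter (T : topologicalType) (f : homeo T) (n : int) : T -> T :=
  match n with
  | Posz k => iter k f
  | Negz k => iter k.+1 (homeo_inv f)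
  end.

(* The metric is a plain function rather than a [metricType] structure, because
   metrics are quantified over on a fixed topological space. *)
Record is_metric (R : realType) (T : Type) (d : T -> T -> R) : Prop := IsMetric {
  metric_ge0 : forall x y, 0 <= d x y;
  metric_eq0 : forall x y, d x y = 0 <-> x = y;
  metric_symm : forall x y, d x y = d y x;
  metric_trian : forall x y z, d x z <= d x y + d y z
}.

Definition compatible_metric (R : realType) (T : topologicalType)
    (d : T -> T -> R) : Prop :=
  is_metric d /\
  forall x : T, nbhs x = nbhs_ball_ (fun y e => [set z | d y z < e]) x.

Definition metrizable (R : realType) (T : topologicalType) : Prop :=
  exists d : T -> T -> R, compatible_metric d.

(* Extended-real valued, so that unbounded sets have diameter [+oo]; the
   diameter of the empty set is [-oo]. *)
Definition diam (R : realType) (T : Type) (d : T -> T -> R) (C : set T) :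
    \bar R :=
  ereal_sup [set (d p.1 p.2)%:E | p in C `*` C].

Definition continuum (T : topologicalType) (C : set T) : Prop :=
  [/\ C !=set0, compact C & connected C].

Definition trivial_set (T : Type) (C : set T) : Prop := exists x, C = [set x].

Definition stable (R : realType) (T : topologicalType) (d : T -> T -> R)
    (f : homeo T) (xi : R) (C : set T) : Prop :=
  forall n : int, (diam d (homeo_iter f n @` C) <= xi%:E)%E.

Definition cw_expansive (R : realType) (T : topologicalType) (f : homeo T) :
    Prop :=
  exists (d : T -> T -> R) (xi : R),
    [/\ compatible_metric d, 0 < xi &
        forall C : set T, continuum C -> stable d f xi C -> trivial_set C].

Definition half_cw_expansive (R : realType) (T : topologicalType)
    (d : T -> T -> R) (f : homeo T) (xi : R) : Prop :=
  0 < xi /\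
  forall C : set T, continuum C -> stable d f xi C -> stable d f (xi / 2) C.

Definition quotient_map (T S : topologicalType) (q : T -> S) : Prop :=
  set_surj [set: T] [set: S] q /\
  forall U : set S, open U <-> open (q @^-1` U).

Definition extension (T S : topologicalType) (f : homeo T) (g : homeo S)
    (q : T -> S) : Prop :=
  quotient_map q /\ q \o f = g \o q.

Definition monotone_extension (T S : topologicalType) (f : homeo T)
    (g : homeo S) (q : T -> S) : Prop :=
  extension f g q /\ forall z : S, connected (q @^-1` [set z]).

(* Main.v *)
Require Import Defs.
From HB Require Import structures.
From mathcomp Require Import all_boot all_order all_algebra.
From mathcomp Require Import all_classical all_reals all_analysis.
From mathcomp Require Import lra.
Set Implicit Arguments.
Unset Strict Implicit.
Unset Printing Implicit Defensive.
Import Order.TTheory GRing.Theory Num.Theory.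
Import numFieldNormedType.Exports.

Local Open Scope classical_set_scope.
Local Open Scope ring_scope.

(** A metric and a constant are produced in each direction.

From (1) to (2). Let [dt] be a metric on the quotient for which [tf] is
cw-expansive with constant [xi]. Take [d x y := dt (q x) (q y) + eps * d0 x
y], where [d0] is any compatible metric on [M] and [eps] is so small that the
second term never exceeds [xi / 2]; a continuous metric on a compact space is
compatible ([continuous_metric_compatible]). If [C] is a [xi]-stable continuum
for [d], then [q @` C] is a [xi]-stable continuum for [dt], hence a point, so
[C] lies in a fiber. On a fiber only the second term survives, so that every
subset of a fiber is [xi / 2]-stable. Thus the same [xi] works, and a fiber is
itself a [xi]-stable continuum joining any two of its points.

From (2) to (1). By hypothesis two points of a fiber lie in a [xi]-stable,
hence [xi / 2]-stable, continuum, so fibers are [xi / 2]-stable. The main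
point is that the relation [q x = q y] is closed. Given [x], consider the set
of all limits of points [y'] lying in a common fiber with points [x'] that
tend to [x] ([limit_fiber]). Any two limits are compared through [x] at a cost
of [xi / 2 + xi / 2], so this set is [xi]-stable ([limit_fiber_stable]), which
is where halving the constant pays off; and it is connected because the fibers
are, so that those near [x] stay on one side of any splitting
([limit_fiber_connected]). So it is a [xi]-stable continuum through [x], and
by hypothesis it lies in the fiber of [x].

A quotient of a compact metrizable space by a closed relation is metrizable
([quotient_metrizable]): the quotient map is closed, so the quotient is
normal; Urysohn's lemma separates its points, and countably many Urysohn
functions suffice because [M] is totally bounded. Fix any metric on the
quotient. Fibers have diameter less than [xi], so by compactness there is [e]
such that sets of diameter at most [e] have preimages of diameter at most [xi]
([small_preimage]). The preimage of an [e]-stable continuum is connected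
([monotone_preimage_connected]), thus a [xi]-stable continuum, thus contained
in a fiber, and the continuum one started from is a point. *)

(** * Compatible metrics *)

Lemma metricxx (R : realType) (T : Type) (d : T -> T -> R) (x : T) :
  is_metric d -> d x x = 0.
Proof. by move=> dm; apply/(metric_eq0 dm). Qed.

Lemma nbhs_compatible (R : realType) (T : topologicalType) (d : T -> T -> R)
    (x : T) (U : set T) :
  compatible_metric d ->
  nbhs x U <-> exists2 e, 0 < e & forall y, d x y < e -> U y.
Proof. by move=> [_ ->]; split => -[e e0 eU]; exists e. Qed.

Lemma near_compatible (R : realType) (T : topologicalType) (d : T -> T -> R)
    (x : T) (e : R) :
  compatible_metric d -> 0 < e -> \forall y \near x, d x y < e.
Proof. by move=> dc e0; apply/(nbhs_compatible _ _ dc); exists e. Qed.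

Lemma compatible_continuous2 (R : realType) (T : topologicalType)
    (d : T -> T -> R) :
  compatible_metric d -> continuous (fun p : T * T => d p.1 p.2).
Proof.
move=> dc [x y]; apply/cvgrPdist_lt => e e0 /=.
have e20 : 0 < e / 2 by rewrite divr_gt0.
exists ([set z | d x z < e / 2], [set z | d y z < e / 2]).
  by split; exact: near_compatible.
move=> [x' y'] /= [xx' yy']; have [dm _] := dc.
have := metric_trian dm x x' y; have := metric_trian dm x' y' y.
have := metric_trian dm x' x y'; have := metric_trian dm x y y'.
rewrite (metric_symm dm x' x) (metric_symm dm y' y) ltr_distl.
by move=> *; apply/andP; split; lra.
Qed.

Lemma continuous_pairl (T U : topologicalType) (x : T) :
  continuous (fun y : U => (x, y)).
Proof.
move=> y; have xc : (fun=> x) @ y --> x by exact: cvg_cst.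
exact: (@cvg_pair _ _ _ (nbhs y) (nbhs x) (nbhs y) _ _ _ _ _ xc cvg_id).
Qed.

Lemma compatible_continuous (R : realType) (T : topologicalType)
    (d : T -> T -> R) (x : T) : compatible_metric d -> continuous (d x).
Proof.
move=> dc y; have dc2 := compatible_continuous2 dc.
have pc := @continuous_pairl T T x y.
exact: (@cvg_comp _ _ _ (pair x) _ _ _ _ pc (dc2 (x, y))).
Qed.

Lemma compatible_hausdorff (R : realType) (T : topologicalType)
    (d : T -> T -> R) : compatible_metric d -> hausdorff_space T.
Proof.
move=> dc x y xy; have [dm _] := dc; apply/(metric_eq0 dm)/eqP.
rewrite eq_le (metric_ge0 dm) andbT leNgt; apply/negP => d0.
have d20 : 0 < d x y / 2 by rewrite divr_gt0.
have [z [/= xz yz]] :=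
  xy _ _ (near_compatible x dc d20) (near_compatible y dc d20).
have := metric_trian dm x z y; rewrite (metric_symm dm z y); lra.
Qed.

(** The balls of a continuous metric are neighbourhoods. Conversely, outside
an open neighbourhood of [x] the function [d x] attains a minimum by
compactness, and this minimum is positive, so a ball around [x] fits into the
neighbourhood. *)
Lemma continuous_metric_compatible (R : realType) (T : topologicalType)
    (d : T -> T -> R) :
  compact [set: T] -> is_metric d -> (forall x, continuous (d x)) ->
  compatible_metric d.
Proof.
move=> cT dm dc; split=> // x; apply/seteqP; split=> U; last first.
  move=> [e /= e0 eU]; have /cvgrPdist_lt/(_ e e0) := dc x x.
  apply: filterS => y; rewrite (metricxx _ dm) sub0r normrN => xy.
  by apply: eU => /=; rewrite (le_lt_trans (ler_norm _)).
rewrite nbhsE => -[V [oV Vx] VU].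
have cV : compact (~` V).
  by apply: (subclosed_compact _ cT) => //; exact: open_closedC.
(* the extreme value theorem needs a point outside [V] *)
have [V0|/set0P V0] := eqVneq (~` V) set0.
  by exists 1 => //= y _; apply: VU; apply: contrapT => nVy;
    have : (~` V) y by []; rewrite V0.
have [|y yV ymin] := @compact_EVT_min _ R (d x) (~` V) V0 cV.
  by apply: continuous_subspaceT; exact: dc.
exists (d x y) => /=.
  rewrite lt_neqAle (metric_ge0 dm) andbT eq_sym; apply/eqP.
  by move=> /(metric_eq0 dm) xy; move: yV; rewrite -xy inE.
move=> z /= xz; apply: VU; apply: contrapT => nVz.
by have := ymin z; rewrite inE => /(_ nVz); rewrite leNgt xz.
Qed.

Lemma compatible_bounded (R : realType) (T : topologicalType)
    (d : T -> T -> R) :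
  compact [set: T] -> compatible_metric d ->
  exists2 D, 0 < D & forall x y, d x y <= D.
Proof.
move=> cT dc; have cTT := compact_setX cT cT; rewrite setXTT in cTT.
have [T0|/set0P T0] := eqVneq [set: T * T] set0.
  by exists 1 => // x y; have : [set: T * T] (x, y) by []; rewrite T0.
have [|p _ pmax] := @compact_EVT_max _ R (fun p : T * T => d p.1 p.2) _ T0 cTT.
  by apply: continuous_subspaceT; exact: compatible_continuous2.
exists (1 + d p.1 p.2); first by rewrite ltr_pwDl// (metric_ge0 dc.1).
by move=> x y; have := pmax (x, y); rewrite inE => /(_ I) /=; lra.
Qed.

(** * Stable sets and iterates *)

Lemma le_diamP (R : realType) (T : Type) (d : T -> T -> R) (C : set T) (r : R) :
  (diam d C <= r%:E)%E <-> forall x y, C x -> C y -> d x y <= r.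
Proof.
split=> [Cr x y Cx Cy|Cr].
  rewrite -lee_fin; apply: le_trans Cr.
  by apply: ereal_sup_ubound; exists (x, y).
by apply: ge_ereal_sup => _ [[x y] [/= Cx Cy] <-]; rewrite lee_fin; exact: Cr.
Qed.

Lemma stableP (R : realType) (T : topologicalType) (d : T -> T -> R)
    (f : homeo T) (xi : R) (C : set T) :
  stable d f xi C <-> forall n x y, C x -> C y ->
    d (homeo_iter f n x) (homeo_iter f n y) <= xi.
Proof.
split=> [Cs n x y Cx Cy|Cs n].
  by move/le_diamP: (Cs n); apply; [exists x|exists y].
by apply/le_diamP => _ _ [x Cx <-] [y Cy <-]; exact: Cs.
Qed.

Lemma homeo_iter_continuous (T : topologicalType) (f : homeo T) (n : int) :
  continuous (homeo_iter f n).
Proof.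
have it (g : T -> T) k : continuous g -> continuous (iter k g).
  move=> cg; elim: k => [|k IH] x; first exact: cvg_id.
  exact: (continuous_comp (IH x) (cg _)).
case: n => k; apply: it; first exact: homeo_continuous.
exact: homeo_inv_continuous.
Qed.

Lemma homeo_iter_semiconj (T S : topologicalType) (f : homeo T) (g : homeo S)
    (q : T -> S) (n : int) (x : T) :
  q \o f = g \o q -> q (homeo_iter f n x) = homeo_iter g n (q x).
Proof.
move=> qf; have qfx y : q (f y) = g (q y) by move/(congr1 (@^~ y)): qf.
have qfVx y : q (homeo_inv f y) = homeo_inv g (q y).
  by rewrite -{2}(homeo_invK f y) qfx homeoK.
by case: n => k; [|rewrite /homeo_iter; move: k.+1 => {}k]; elim: k => //= k IH;
  rewrite ?qfx ?qfVx IH.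
Qed.

(** * Quotient maps and connectedness *)

Lemma quotient_map_continuous (T S : topologicalType) (q : T -> S) :
  quotient_map q -> continuous q.
Proof. by move=> [_ qo]; apply/continuousP => U /qo. Qed.

Lemma quotient_map_surj (T S : topologicalType) (q : T -> S) :
  quotient_map q -> forall z, exists x, q x = z.
Proof. by move=> [qs _] z; have [x _ <-] := qs z I; exists x. Qed.

Lemma quotient_map_closedP (T S : topologicalType) (q : T -> S) (F : set S) :
  quotient_map q -> closed F <-> closed (q @^-1` F).
Proof. by move=> [_ qo]; rewrite -!openC; exact: qo. Qed.

Lemma quotient_map_compact (T S : topologicalType) (q : T -> S) :
  compact [set: T] -> quotient_map q -> compact [set: S].
Proof.
move=> cT qq; have -> : [set: S] = q @` [set: T].
  apply/seteqP; split => // z _.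
  by have [x <-] := quotient_map_surj qq z; exists x.
apply: continuous_compact => //; apply: continuous_subspaceT.
exact: quotient_map_continuous.
Qed.

Lemma connected_sub_open (T : topologicalType) (A U V : set T) (x : T) :
  connected A -> open U -> open V -> U `&` V = set0 ->
  A `<=` U `|` V -> A x -> U x -> A `<=` U.
Proof.
move=> cA oU oV UV AUV Ax Ux.
have sep (B C : set T) : open C -> B `&` C = set0 -> closure B `&` C = set0.
  move=> oC BC; rewrite -subset0 => y [clB Cy].
  by have := clB _ (open_nbhs_nbhs (conj oC Cy)); rewrite BC => -[].
have sUV : separated U V.
  by split; [exact: sep|rewrite setIC; apply: sep => //; rewrite setIC].
have [//|AV] := connected_subset sUV AUV cA.
by have : (U `&` V) x; [split=> //; exact: AV|rewrite UV].
Qed.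

(** * Metrizability of the quotient *)

(** A countable separating family embeds [T] into a countable product of
copies of [R], which is a pseudometric space of diameter at most [2]. The
metric is the pullback of the distance of that product; it is continuous,
hence compatible. *)
Lemma metrizable_separating_family (R : realType) (T : topologicalType)
    (I : countType) (g : I -> T -> R) :
  compact [set: T] -> (forall i, continuous (g i)) ->
  (forall x y, x <> y -> exists i, g i x <> g i y) -> metrizable R T.
Proof.
move=> cT gc gsep.
pose P : pseudoMetricType R :=
  prod_topology (fun _ : I => R : pseudoMetricType R).
pose h : T -> P := fun x i => g i x.
have hc : continuous h.
  move=> x; apply/cvg_sup => i U [V [[W oW <-] /= Wx] WU].
  by apply: filterS WU _; apply: gc; exact: open_nbhs_nbhs.
have fin (u v : P) : edist (u, v) \is a fin_num.
  apply/edist_finP; exists 2 => //.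
  exact: countable_uniform.countable_uniform_bounded.
exists (fun x y => fine (edist (h x, h y))).
apply: continuous_metric_compatible => //.
  split=> [x y|x y|x y|x y z].
  - by rewrite fine_ge0 // edist_ge0.
  - split=> [e0|->]; last by rewrite edist_refl.
    apply: contrapT => /gsep[i]; apply.
    have /edist_closeP hxy : edist (h x, h y) = 0%E.
      by rewrite -(fineK (fin _ _)) e0.
    have hs : hausdorff_space P.
      by apply: hausdorff_product => _; exact: norm_hausdorff.
    by have /(congr1 (@^~ i)) := close_eq hs hxy.
  - by rewrite edist_sym.
  - by rewrite -lee_fin EFinD !fineK //; exact: edist_triangle.
move=> x y; apply: fine_cvg; rewrite fineK //.
have hp : (h x, h z) @[z --> y] --> (h x, h y).
  exact: (cvg_comp _ _ (hc y) (@continuous_pairl P P (h x) (h y))).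
exact: (cvg_comp _ _ hp (@edist_continuous _ _ (h x, h y))).
Qed.

(** Compactness is applied with finite sequences ordered by inclusion: near
every [x], all sequences that contain [x] have a point close by. *)
Lemma finite_net (R : realType) (T : topologicalType) (d : T -> T -> R)
    (e : R) :
  compact [set: T] -> compatible_metric d -> 0 < e ->
  exists s : seq T, forall x, exists2 y, y \in s & d y x < e.
Proof.
move=> /compact_near_coveringP cT dc e0.
pose F : set_system (seq T) :=
  filter_from [set: seq T] (fun s => [set s' : seq T | {subset s <= s'}]).
have FF : Filter F.
  apply: filter_from_filter => [|s s' _ _]; first by exists [::].
  exists (s ++ s') => // s'' ss; split=> y ys; apply: ss; rewrite mem_cat ys //.
  by rewrite orbT.
have [|s _ sT] := cT (seq T) F (fun s x => exists2 y, y \in s & d y x < e) FF.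
  move=> x _.
  exists ([set y | d x y < e], [set s : seq T | {subset [:: x] <= s}]) => /=.
    by split; [exact: near_compatible|exists [:: x]].
  by move=> [y s] /= [xy xs]; exists x => //; apply: xs; rewrite inE.
by exists s => x; exact: (sT s).
Qed.

(** The index [(n, i, j)] stands for the pair formed by the [i]-th and the
[j]-th ball of a finite cover by balls of radius [n.+1%:R^-1]. For each pair
of balls whose images some continuous function separates by the level [1 / 2],
one such function is chosen. Any function separating [q x] and [q y] does so
for a pair of balls around [x] and [y] of small radius, so the chosen function
for this pair separates them as well. *)
Lemma countable_separating_family (R : realType) (T S : topologicalType)
    (d : T -> T -> R) (q : T -> S) :
  compact [set: T] -> compatible_metric d -> quotient_map q ->
  (forall x y, q x <> q y ->
    exists g : S -> R, [/\ continuous g, g (q x) = 0 & g (q y) = 1]) ->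
  exists g : nat * nat * nat -> S -> R,
    (forall i, continuous (g i)) /\
    (forall z w, z <> w -> exists i, g i z <> g i w).
Proof.
move=> cT dc qq qsep; have [dm _] := dc.
have /choice[net netP] (n : nat) :
    exists s : seq T, forall x, exists2 y, y \in s & d y x < n.+1%:R^-1.
  by apply: finite_net => //; rewrite invr_gt0.
(* out of range, the cell is empty, so that the index set can be countable
   without a point of [T] as a default value *)
pose B n i := nth set0 [seq [set x | d y x < n.+1%:R^-1] | y <- net n] i.
pose P (k : nat * nat * nat) (g : S -> R) :=
  (forall a, B k.1.1 k.1.2 a -> g (q a) < 1 / 2) /\
  (forall a, B k.1.1 k.2 a -> 1 / 2 < g (q a)).
have /choice[g gP] k : exists g : S -> R, continuous g /\
    ((exists2 g', continuous g' & P k g') -> P k g).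
  have [[g gc Pg]|nP] := pselect (exists2 g, continuous g & P k g).
    by exists g.
  by exists (fun=> 0); split => // x; exact: cvg_cst.
exists g; split=> [k|z w]; first by have [] := gP k.
have [x <-] := quotient_map_surj qq z; have [y <-] := quotient_map_surj qq w.
move=> /[dup] xy /qsep[u [uc ux uy]].
have uqc : continuous (u \o q).
  have qc : continuous q by exact: quotient_map_continuous.
  by move=> a; exact: (continuous_comp (qc a) (uc (q a))).
have /(nbhs_compatible _ _ dc)[e e0 xe] : \forall a \near x, u (q a) < 1 / 2.
  by apply: (cvgr_lt _ (uqc x)); rewrite /= ux; lra.
have /(nbhs_compatible _ _ dc)[e' e'0 ye'] : \forall a \near y, 1 / 2 < u (q a).
  by apply: (cvgr_gt _ (uqc y)); rewrite /= uy; lra.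
(* two points of a common ball are at distance less than twice its radius *)
have [n nee'] : exists n : nat, n.+1%:R^-1 < Num.min e e' / 2.
  have /ltr_add_invr[n] : 0 < Num.min e e' / 2 by rewrite divr_gt0// lt_min e0.
  by rewrite add0r; exists n.
have cell a : exists2 i, B n i a &
    forall b, B n i b -> d a b < Num.min e e'.
  have [c cn ca] := netP n a; exists (index c (net n)).
    by rewrite /B (nth_map c) ?index_mem// nth_index.
  move=> b; rewrite /B (nth_map c) ?index_mem// nth_index//= => cb.
  have := metric_trian dm a c b; rewrite (metric_symm dm a c).
  by move: (Num.min e e') nee' ca cb => m; move: (_^-1) => v; lra.
have [i Bx Bxe] := cell x; have [j By Bye] := cell y.
have [_ []] := gP (n, i, j).
  exists u => //; split=> /= a.
    by move/Bxe; rewrite lt_min => /andP[+ _]; exact: xe.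
  by move/Bye; rewrite lt_min => /andP[_]; exact: ye'.
move=> /= /(_ _ Bx) gx /(_ _ By) gy; exists (n, i, j) => gxy.
by move: gx; rewrite gxy ltNge (ltW gy).
Qed.

Section limit_fiber.
Variables (T S : topologicalType) (q : T -> S).

(** The fiber of [x] in the closure of the relation [q x = q y]: the points
that are limits of points [y'] with [q x' = q y'] for some [x'] tending to
[x]. *)
Definition limit_fiber (x : T) : set T :=
  [set y | closure [set p : T * T | q p.1 = q p.2] (x, y)].

Lemma limit_fiber_refl x : limit_fiber x x.
Proof. exact: subset_closure. Qed.

(** Tube lemma: the complement of the closure of [q x = q y] contains
[{x} * A], hence, [A] being compact, a neighbourhood of [x] times [A]. *)
Lemma limit_fiber_tube (A : set T) (x : T) :
  compact [set: T] -> closed A -> (forall a, A a -> ~ limit_fiber x a) ->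
  \forall x' \near x, forall a, A a -> q x' <> q a.
Proof.
move=> cT clA xA.
have /compact_near_coveringP cA := subclosed_compact clA cT (@subsetT _ A).
apply: (cA _ (nbhs x) (fun x' a => q x' <> q a)) => a /xA xa.
have := closed_openC (@closed_closure _ [set p : T * T | q p.1 = q p.2]).
rewrite openE => /(_ (x, a) xa) [[U V] /= [Ux Va] UV].
exists (V, U) => // -[a' x'] /= [Va' Ux'] xa'.
by apply: (UV (x', a')) => //; exact: subset_closure.
Qed.

Lemma limit_fiber_closed x : closed (limit_fiber x).
Proof.
apply: (@preimage_closed _ _ (fun y => (x, y))); last exact: closed_closure.
by move=> y _; exact: continuous_pairl.
Qed.

End limit_fiber.

Section closed_relation.
Variables (T S : topologicalType) (q : T -> S).
Hypotheses (cT : compact [set: T]) (hT : hausdorff_space T).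
Hypothesis qq : quotient_map q.
Hypothesis qcl : closed [set p : T * T | q p.1 = q p.2].

(** By the tube lemma, the set of points whose fiber avoids a closed set is
open. *)
Lemma closed_image (A : set T) : closed A -> closed (q @` A).
Proof.
move=> clA; apply/(quotient_map_closedP _ qq); rewrite -openC openE => x nAx.
have xA a : A a -> ~ limit_fiber q x a.
  by move=> Aa /qcl /= xa; apply: nAx; exists a.
apply: filterS (limit_fiber_tube cT clA xA) => x' x'A [a Aa ax'].
exact: (x'A a).
Qed.

Lemma closed_point (z : S) : closed [set z].
Proof.
have [x <-] := quotient_map_surj qq z; rewrite -(image_set1 q x).
by apply: closed_image; apply: compact_closed => //; exact: compact_set1.
Qed.

(** Disjoint closed sets are pulled back to [T] and separated there by [U] and
[V]; the sets of points whose fiber lies in [U], respectively in [V], are open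
because the quotient map is closed. *)
Lemma quotient_normal (R : realType) : normal_space S.
Proof.
apply/(@normal_openP R) => A B clA clB AB.
have nT := compact_normal hT cT.
have [] := (@normal_openP R T).1 nT (q @^-1` A) (q @^-1` B).
- exact/(quotient_map_closedP _ qq).
- exact/(quotient_map_closedP _ qq).
- by rewrite -preimage_setI AB preimage_set0.
move=> U [V [oU oV AU BV UV]].
exists (~` (q @` ~` U)), (~` (q @` ~` V)); split.
- by rewrite openC; apply: closed_image; exact: open_closedC.
- by rewrite openC; apply: closed_image; exact: open_closedC.
- by move=> z Az [x nUx xz]; apply/nUx/AU; rewrite /= xz.
- by move=> z Bz [x nVx xz]; apply/nVx/BV; rewrite /= xz.
rewrite -subset0 => z; have [x <-] := quotient_map_surj qq z => -[nU nV].
have : (U `&` V) x; last by rewrite UV.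
by split; apply: contrapT => nx; [apply: nU|apply: nV]; exists x.
Qed.

Lemma quotient_urysohn (R : realType) (z w : S) : z <> w ->
  exists g : S -> R, [/\ continuous g, g z = 0 & g w = 1].
Proof.
move=> zw.
have /(uniform_separatorP (R := R))[g [gc _ g0 g1]] :
    uniform_separator [set z] [set w].
  apply: (normal_uniform_separator (quotient_normal R));
    [exact: closed_point|exact: closed_point|].
  by rewrite -subset0 => _ [->].
by exists g; split => //; [apply: g0|apply: g1]; [exists z|exists w].
Qed.

End closed_relation.

Lemma quotient_metrizable (R : realType) (T S : topologicalType) (q : T -> S) :
  compact [set: T] -> metrizable R T -> quotient_map q ->
  closed [set p : T * T | q p.1 = q p.2] -> metrizable R S.
Proof.
move=> cT [d dc] qq qcl.
have [x y xy|g [gc gsep]] := @countable_separating_family R T S d q cT dc qq.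
  apply: (quotient_urysohn cT _ qq qcl) => //.
  exact: compatible_hausdorff dc.
by apply: (metrizable_separating_family (quotient_map_compact cT qq) gc gsep).
Qed.

(** * Preimages of connected sets *)

(** A clopen part of the preimage of [D] meets each fiber over [D] in a clopen
part of that fiber, so it is a union of fibers. It is then the preimage of a
part of [D], which is clopen in [D] by definition of the quotient topology. *)
Lemma monotone_preimage_connected (T S : topologicalType) (q : T -> S)
    (D : set S) :
  quotient_map q -> (forall z, connected (q @^-1` [set z])) ->
  closed D -> connected D -> connected (q @^-1` D).
Proof.
move=> qq qconn clD cD B [b Bb] [C oC BC] [C' clC' BC'].
have sat x y : D (q x) -> q x = q y -> C x -> C y.
  move=> Dx xy Cx.
  suff FC : q @^-1` [set q x] `&` C = q @^-1` [set q x].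
    by have : (q @^-1` [set q x]) y by []; rewrite -FC => -[].
  apply: qconn; first by exists x.
    by exists C.
  exists C' => //; apply/seteqP; split=> u [/= ux Cu]; split=> //.
    have : (q @^-1` D `&` C) u by split => //=; rewrite ux.
    by rewrite -BC BC' => -[].
  have : (q @^-1` D `&` C') u by split => //=; rewrite ux.
  by rewrite -BC' BC => -[].
have clqD : closed (q @^-1` D) by apply/(quotient_map_closedP _ qq).
suff qB : q @` B = D.
  rewrite BC; apply/seteqP; split=> [x []//|x Dx]; split=> //.
  move: (Dx); rewrite /= -qB => -[y]; rewrite BC => -[Dy Cy] yx.
  exact: sat yx Cy.
apply: cD; first by exists (q b), b.
  exists (~` (q @` (q @^-1` D `&` ~` C))).
    rewrite openC; apply/(quotient_map_closedP _ qq).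
    suff -> : q @^-1` (q @` (q @^-1` D `&` ~` C)) = q @^-1` D `&` ~` C.
      by apply: closedI => //; exact: open_closedC.
    apply/seteqP; split=> [x [y [Dy nCy] yx]|x Dx]; last by exists x.
    split; first by rewrite /= -yx.
    by move=> Cx; apply: nCy; apply: (sat x) => //; rewrite -yx.
  apply/seteqP; split=> [_ [x Bx <-]|z [Dz nz]].
    move: Bx; rewrite BC => -[Dx Cx]; split=> // -[y [Dy nCy] yx].
    by apply: nCy; apply: (sat x).
  have [x xz] := quotient_map_surj qq z; exists x => //; rewrite BC; split.
    by rewrite /= xz.
  apply: contrapT => nCx; apply: nz; exists x => //.
  by split => //=; rewrite xz.
exists (q @` B).
  apply/(quotient_map_closedP _ qq).
  suff -> : q @^-1` (q @` B) = B by rewrite BC'; exact: closedI.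
  apply/seteqP; split=> [x [y]|x Bx]; last by exists x.
  rewrite BC => -[Dy Cy] yx; split; first by rewrite /= -yx.
  exact: (sat y).
by apply/seteqP; split=> [_ [x Bx <-]|z []//]; split;
  [move: Bx; rewrite BC => -[]|exists x].
Qed.

(** * Limits of small connected fibers *)

Section limit_of_fibers.
Variables (R : realType) (T S : topologicalType) (d : T -> T -> R).
Variables (f : homeo T) (q : T -> S) (xi : R).
Hypotheses (cT : compact [set: T]) (dc : compatible_metric d).
Hypothesis qconn : forall z, connected (q @^-1` [set z]).
Hypothesis fiber_small : forall n x y, q x = q y ->
  d (homeo_iter f n x) (homeo_iter f n y) <= xi / 2.

(** Two points [y1] and [y2] of the limit fiber are close to points [z1] and
[z2] whose fibers contain points [x1] and [x2] close to [x]. The chain [y1,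
z1, x1, x, x2, z2, y2] crosses two fibers, each of which costs at most [xi /
2], and its four other steps are arbitrarily small. *)
Lemma limit_fiber_stable x : stable d f xi (limit_fiber q x).
Proof.
have [dm _] := dc.
apply/stableP => n y1 y2 Ky1 Ky2; apply/ler_addgt0Pr => e e0.
have e40 : 0 < e / 4 by rewrite divr_gt0.
pose N z := [set z' | d (homeo_iter f n z) (homeo_iter f n z') < e / 4].
have nbhsN z : nbhs z (N z).
  exact: (homeo_iter_continuous (near_compatible (homeo_iter f n z) dc e40)).
have pick y : limit_fiber q x y ->
    exists x' y', [/\ q x' = q y', N x x' & N y y'].
  move=> Ky; have [|[x' y'] [xy' [/= xx' yy']]] := Ky (N x `*` N y).
    by exists (N x, N y) => //; split; exact: nbhsN.
  by exists x', y'.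
have [x1 [z1 [/fiber_small-/(_ n) xz1 xx1 yz1]]] := pick y1 Ky1.
have [x2 [z2 [/fiber_small-/(_ n) xz2 xx2 yz2]]] := pick y2 Ky2.
move: yz1 yz2 xx1 xx2 xz1 xz2; rewrite /N /=; set fy1 := homeo_iter f n y1.
set fy2 := homeo_iter f n y2; set fx := homeo_iter f n x.
set fx1 := homeo_iter f n x1; set fx2 := homeo_iter f n x2.
set fz1 := homeo_iter f n z1; set fz2 := homeo_iter f n z2.
have := metric_trian dm fy1 fz1 fy2; have := metric_trian dm fz1 fx1 fy2.
have := metric_trian dm fx1 fx fy2; have := metric_trian dm fx fx2 fy2.
have := metric_trian dm fx2 fz2 fy2.
rewrite (metric_symm dm fz1 fx1) (metric_symm dm fx1 fx).
rewrite (metric_symm dm fz2 fy2).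
lra.
Qed.

(** Points [x'] close to [x] lie in [U] and, by the tube lemma, have their
fibers inside [U `|` V]; such fibers are connected, so they stay in [U]. A
limit of points of these fibers cannot lie in the open set [V]. *)
Lemma limit_fiber_one_side (U V : set T) (x : T) :
  open U -> open V -> U `&` V = set0 ->
  limit_fiber q x `<=` U `|` V -> U x -> limit_fiber q x `<=` U.
Proof.
move=> oU oV UV KUV Ux y Ky; have [//|Vy] := KUV y Ky.
have tube : \forall x' \near x, forall a, (~` (U `|` V)) a -> q x' <> q a.
  apply: limit_fiber_tube => //; first exact/open_closedC/openU.
  by move=> a nUVa /KUV.
have [|[x' y'] [xy' [[/= Ux' x'UV] /= Vy']]] := Ky
    ((U `&` [set x' | forall a, (~` (U `|` V)) a -> q x' <> q a]) `*` V).
  exists (U `&` [set x' | forall a, (~` (U `|` V)) a -> q x' <> q a], V) => //.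
  by split; [apply: filterI => //|]; exact: open_nbhs_nbhs.
have /(_ y') Uy' : q @^-1` [set q x'] `<=` U.
  apply: (connected_sub_open (x := x') (qconn (z := q x')) oU oV) => //.
  by move=> a /= ax'; apply: contrapT => /x'UV; rewrite ax'.
by have : (U `&` V) y'; [split=> //; exact: Uy'|rewrite UV].
Qed.

(** By normality a splitting into two disjoint closed parts is realized by
disjoint open sets, and the part that does not contain [x] is empty. *)
Lemma limit_fiber_connected x : connected (limit_fiber q x).
Proof.
move=> B [b Bb] [C oC BC] [C' clC' BC'].
have nT := compact_normal (compatible_hausdorff dc) cT.
have clK := @limit_fiber_closed T S q x.
have [] := (@normal_openP R T).1 nT B (limit_fiber q x `&` ~` C).
- by rewrite BC'; exact: closedI.
- by apply: closedI => //; exact: open_closedC.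
- by rewrite BC -subset0 => y [[_ ?] [_]].
move=> U [V [oU oV BU KV UV]].
have KUV : limit_fiber q x `<=` U `|` V.
  move=> y Ky; have [Cy|nCy] := pselect (C y); last by right; apply: KV.
  by left; apply: BU; rewrite BC.
have VU : V `&` U = set0 by rewrite setIC.
have [Kb _] : (limit_fiber q x `&` C) b by rewrite -BC.
have [Ux|Vx] := KUV _ (@limit_fiber_refl T S q x).
  have KU := limit_fiber_one_side oU oV UV KUV Ux.
  rewrite BC; apply/seteqP; split=> [y []//|y Ky]; split=> //.
  apply: contrapT => nCy; have : (U `&` V) y; last by rewrite UV.
  by split; [exact: KU|exact: KV].
rewrite setUC in KUV.
have /(_ _ Kb) Vb := limit_fiber_one_side oV oU VU KUV Vx.
by have : (U `&` V) b; [split=> //; exact: BU|rewrite UV].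
Qed.

Lemma limit_fiber_continuum x : continuum (limit_fiber q x).
Proof.
split; [by exists x; exact: limit_fiber_refl| |exact: limit_fiber_connected].
exact: subclosed_compact (@limit_fiber_closed T S q x) cT (@subsetT _ _).
Qed.

End limit_of_fibers.

(** * The two implications *)

(** On the compact set of pairs at distance at least [xi] the distance of the
images is positive, hence bounded away from zero. *)
Lemma small_preimage (R : realType) (T S : topologicalType) (d : T -> T -> R)
    (dS : S -> S -> R) (q : T -> S) (xi : R) :
  compact [set: T] -> compatible_metric d -> compatible_metric dS ->
  continuous q -> (forall x y, q x = q y -> d x y < xi) ->
  exists2 e, 0 < e & forall x y, dS (q x) (q y) <= e -> d x y <= xi.
Proof.
move=> cT dc dSc qc qsmall; have [dSm _] := dSc.
have cTT := compact_setX cT cT; rewrite setXTT in cTT.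
pose A := [set p : T * T | xi <= d p.1 p.2].
have clA : closed A.
  apply: (@preimage_closed _ _ (fun p : T * T => d p.1 p.2) [set r | xi <= r]).
    by move=> p _; exact: compatible_continuous2.
  exact: closed_ge.
have cA : compact A by exact: subclosed_compact clA cTT _.
have [A0|/set0P A0] := eqVneq A set0.
  exists 1 => // x y _; rewrite leNgt; apply/negP => xy.
  by have : A (x, y); [exact: ltW|rewrite A0].
have [|p pA pmin] :=
    @compact_EVT_min _ R (fun p : T * T => dS (q p.1) (q p.2)) A A0 cA.
  apply: continuous_subspaceT => p.
  have q1 : q \o fst @ p --> q p.1.
    by apply: cvg_comp; [exact: cvg_fst|exact: qc].
  have q2 : q \o snd @ p --> q p.2.
    by apply: cvg_comp; [exact: cvg_snd|exact: qc].
  have qpc : (fun p : T * T => (q p.1, q p.2)) @ p --> (q p.1, q p.2).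
    exact: (@cvg_pair _ _ _ (nbhs p) (nbhs (q p.1)) (nbhs (q p.2))
              _ _ _ _ _ q1 q2).
  exact: (cvg_comp _ _ qpc (@compatible_continuous2 _ _ _ dSc (q p.1, q p.2))).
have d0 : 0 < dS (q p.1) (q p.2).
  rewrite lt_neqAle (metric_ge0 dSm) andbT eq_sym; apply/eqP.
  move/(metric_eq0 dSm)/qsmall; move: pA; rewrite inE /A /=.
  by move=> /le_lt_trans /[apply]; rewrite ltxx.
(* the minimum may be attained at a pair at distance more than [xi] *)
exists (dS (q p.1) (q p.2) / 2); first by rewrite divr_gt0.
move=> x y xy; rewrite leNgt; apply/negP => /ltW dxy.
by have := pmin (x, y); rewrite inE => /(_ dxy) /=; lra.
Qed.

(** The metric of the quotient is pulled back and perturbed into a metric; the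
perturbation is too small to be noticed at scale [xi / 2]. *)
Lemma cw_expansive_half_cw_expansive (R : realType) (M tM : topologicalType)
    (f : homeo M) (tf : homeo tM) (q : M -> tM) :
  compact [set: M] -> metrizable R M -> monotone_extension f tf q ->
  cw_expansive R tf ->
  exists (d : M -> M -> R) (xi : R),
    [/\ compatible_metric d, half_cw_expansive d f xi &
        forall x y : M, q x = q y <->
          exists C : set M, [/\ continuum C, stable d f xi C, C x & C y]].
Proof.
move=> cM [d0 d0c] [[qq qf] qconn] [dt [xi [dtc xi0 tfexp]]].
have [D D0 d0D] := compatible_bounded cM d0c.
have [d0m _] := d0c; have [dtm _] := dtc.
have qc : continuous q by exact: quotient_map_continuous.
pose eps := xi / 2 / D.
have eps0 : 0 < eps by rewrite !divr_gt0.
have epsD x y : eps * d0 x y <= xi / 2.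
  by rewrite -[leRHS](@divfK _ D) ?gt_eqF// ler_pM2l.
pose d x y := dt (q x) (q y) + eps * d0 x y.
have dc : compatible_metric d.
  apply: continuous_metric_compatible => //.
    split=> [x y|x y|x y|x y z].
    - by rewrite addr_ge0 ?(metric_ge0 dtm)// mulr_ge0 ?(metric_ge0 d0m)// ltW.
    - split=> [/eqP|->]; last by rewrite /d !metricxx// mulr0 addr0.
      rewrite paddr_eq0 ?(metric_ge0 dtm)//; last first.
        by rewrite mulr_ge0 ?(metric_ge0 d0m)// ltW.
      by move=> /andP[_]; rewrite mulf_eq0 gt_eqF//= => /eqP/(metric_eq0 d0m).
    - by rewrite /d (metric_symm dtm) (metric_symm d0m).
    - have := metric_trian dtm (q x) (q y) (q z).
      have := metric_trian d0m x y z; rewrite -(ler_pM2l eps0) mulrDr /d.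
      by lra.
  move=> x; have dtx : continuous (dt (q x)) by exact: compatible_continuous.
  have d0x : continuous (d0 x) by exact: compatible_continuous.
  move=> y; apply: cvgD; last by apply: cvgMr; exact: d0x.
  exact: (cvg_comp _ _ (qc y) (dtx (q y))).
have collapse C : continuum C -> stable d f xi C ->
    exists z, C `<=` q @^-1` [set z].
  move=> [[c Cc] cC connC] /stableP Cs.
  have [||z qCz] := tfexp (q @` C).
  - split; first by exists (q c), c.
      by apply: continuous_compact => //; exact: continuous_subspaceT.
    by apply: connected_continuous_connected => //; exact: continuous_subspaceT.
  - apply/stableP => n _ _ [x Cx <-] [y Cy <-].
    rewrite -!(homeo_iter_semiconj _ _ qf); apply: le_trans (Cs n x y Cx Cy).
    by rewrite lerDl mulr_ge0 ?(metric_ge0 d0m)// ltW.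
  by exists z => x Cx; rewrite /= -[_ = _]/([set z] (q x)) -qCz; exists x.
have fiber_half (C : set M) z : C `<=` q @^-1` [set z] -> stable d f (xi / 2) C.
  move=> Cz; apply/stableP => n x y /Cz xz /Cz yz.
  rewrite /d !(homeo_iter_semiconj _ _ qf) xz yz (metricxx _ dtm) add0r.
  exact: epsD.
exists d, xi; split=> //.
  by split=> // C Cc /(collapse _ Cc)[z /fiber_half].
move=> x y; split=> [xy|[C [Cc Cs Cx Cy]]]; last first.
  by have [z Cz] := collapse _ Cc Cs; rewrite (Cz x Cx) (Cz y Cy).
exists (q @^-1` [set q x]); split=> //.
  split; [by exists x| |exact: qconn].
  apply: subclosed_compact cM _ => //; apply: preimage_closed.
    by move=> z _; exact: qc.
  by apply: compact_closed (compatible_hausdorff dtc) _; exact: compact_set1.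
move=> n; apply: le_trans (fiber_half _ _ (@subset_refl _ _) n) _.
by rewrite lee_fin; lra.
Qed.

(** The closure of the relation [q x = q y] adds no pair, because a limit fiber
is a [xi]-stable continuum and such continua are contained in fibers. *)
Lemma half_cw_expansive_cw_expansive (R : realType) (M tM : topologicalType)
    (f : homeo M) (tf : homeo tM) (q : M -> tM) (d : M -> M -> R) (xi : R) :
  compact [set: M] -> monotone_extension f tf q ->
  compatible_metric d -> half_cw_expansive d f xi ->
  (forall x y : M, q x = q y <->
    exists C : set M, [/\ continuum C, stable d f xi C, C x & C y]) ->
  cw_expansive R tf.
Proof.
move=> cM [[qq qf] qconn] dc [xi0 half] qC; have [dm _] := dc.
have fiber_small n x y : q x = q y ->
    d (homeo_iter f n x) (homeo_iter f n y) <= xi / 2.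
  by move/qC => [C [Cc /(half _ Cc)/stableP Cs Cx Cy]]; exact: Cs.
have qcl : closed [set p : M * M | q p.1 = q p.2].
  move=> [x y] xy /=; apply/qC; exists (limit_fiber q x); split.
  - exact: limit_fiber_continuum cM dc qconn x.
  - exact: limit_fiber_stable.
  - exact: limit_fiber_refl.
  - exact: xy.
have [dt dtc] : metrizable R tM.
  by apply: (quotient_metrizable cM _ qq qcl); exists d.
have qc : continuous q by exact: quotient_map_continuous.
have [e e0 eP] : exists2 e, 0 < e &
    forall x y, dt (q x) (q y) <= e -> d x y <= xi.
  apply: small_preimage => // x y /(fiber_small 0) /=; lra.
exists dt, e; split=> // D [[z Dz] cD connD] /stableP Ds.
have clD : closed D := compact_closed (compatible_hausdorff dtc) cD.
have [x xz] := quotient_map_surj qq z.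
exists z; apply/seteqP; split=> [w Dw|w ->//].
have [y yw] := quotient_map_surj qq w.
rewrite -xz -yw; apply/qC; exists (q @^-1` D); split => /=.
- split; first by exists x; rewrite /= xz.
    by apply: subclosed_compact cM _ => //; apply/(quotient_map_closedP _ qq).
  exact: monotone_preimage_connected.
- apply/stableP => n u v Du Dv; apply: eP.
  by rewrite !(homeo_iter_semiconj _ _ qf); exact: Ds.
- by rewrite yw.
- by rewrite xz.
Qed.

Theorem theorem2p12 (R : realType) (M tM : topologicalType)
    (f : homeo M) (tf : homeo tM) (q : M -> tM)
    (M_compact : compact [set: M]) (M_metrizable : metrizable R M)
    (f_ext : monotone_extension f tf q) :
  cw_expansive R tf <->
  exists (d : M -> M -> R) (xi : R),
    [/\ compatible_metric d,
        half_cw_expansive d f xi &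
        forall x y : M,
          q x = q y <->
          exists C : set M, [/\ continuum C, stable d f xi C, C x & C y]].
Proof.
split; first exact: cw_expansive_half_cw_expansive.
by move=> [d [xi [dc half qC]]]; exact: half_cw_expansive_cw_expansive half qC.
Qed.
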